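(* Consider the push-sum algorithm $x(t+1)=W(t)x(t)$, $y(t+1)=W(t)y(t)$, $t\ge 0$, with $x(0)\in\mathbb{R}^n$ and $y(0)=\mathbf{1}_n$, where $\{W(t)\}_{t\ge 0}$ is the random sequence of column-stochastic push-sum matrices associated with a sequence of random directed graphs with self-loops at every node. Suppose that $\{W(t)\}$ has the directed infinite flow property almost surely. Then, almost surely, for all $i\in[n]$ and all $t\ge 0$, $$\left| z_i(t+1)-\bar{x}\right|\le \frac{2\|x(0)\|_1}{y_i(t+1)}\,\Lambda_{t,0},$$ where $\Lambda_{t,0}=\prod_{q\in\mathbb{Q}_{t,0}}\lambda_q$ and $\lambda_q=\left(1-\frac{1}{n^{\ell_q}}\right)\in(0,1)$.
   Context: Let $n\ge 2$, $[n]=\{1,\dots,n\}$; time indices $t$ range over non-negative integers. $\mathbf{1}_n\in\mathbb{R}^n$ is the all-ones vector and $\|\cdot\|_1$ the $1$-norm. Push-sum matrices: on a probability space $(\Omega,\mathcal{B},\mu)$, $\{\mathcal{G}(t)\}_{t\ge 0}$ is a sequence of random directed graphs on nodes $v_1,\dots,v_n$, each containing a self-loop at every node for all $t$. Let $d^{\mathrm{out}}_j(t)$ be the number of out-neighbors of $v_j$ in $\mathcal{G}(t)$ (including itself). The random matrix $W(t)$ is given by $W_{ij}(t)=1/d^{\mathrm{out}}_j(t)$ if $(v_j,v_i)$ is an edge of $\mathcal{G}(t)$, and $W_{ij}(t)=0$ otherwise; it is column-stochastic (each column sums to 1) with positive diagonal. Push-sum: $x(0)$ is the vector of initial states, $\bar{x}=\frac1n\sum_{i=1}^n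 x_i(0)$, and $z_i(t+1)=x_i(t+1)/y_i(t+1)$. For a non-negative $n\times n$ matrix $A$ and $S\subset[n]$ with complement $\bar S$, $A_{S\bar S}=\sum_{i\in S,j\in\bar S}A_{ij}$. A subset is non-trivial if it is neither $\emptyset$ nor $[n]$. A sequence $\{A(t)\}_{t\ge0}$ of non-negative matrices has the directed infinite flow property if $\sum_{t=0}^\infty A_{S\bar S}(t)=\infty$ for every non-trivial $S\subset[n]$. The following are defined along each sample path with $A(t)=W(t)$: $k_0=0$, and for $q\ge1$, $k_q$ is the smallest integer $t'>k_{q-1}$ such that $\sum_{t=k_{q-1}}^{t'-1}A_{S\bar S}(t)>0$ for every non-trivial $S\subset[n]$. For $q\ge1$, $\ell_q=k_{qn}-k_{(q-1)n}$. For $t>s\ge0$, $\mathbb{Q}_{t,s}=\{q\ge 1: s\le k_{(q-1)n},\ k_{qn}\le t\}$ (empty for $t=s$); empty products equal 1. *)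

(* Defs.v *)
From HB Require Import structures.
From mathcomp Require Import all_boot all_order all_algebra.
From mathcomp Require Import all_classical all_reals all_analysis.

Set Implicit Arguments.
Unset Strict Implicit.
Unset Printing Implicit Defensive.

Import Order.TTheory GRing.Theory Num.Theory.
Import numFieldNormedType.Exports.

Local Open Scope ring_scope.

(* A directed graph on the nodes v_1, ..., v_n is [E : rel 'I_n], where
   [E j i] says that (v_j, v_i) is an edge. *)
Definition out_degree (n : nat) (E : rel 'I_n) (j : 'I_n) : nat := #|E j|.

Definition push_sum_mx (R : realType) (n : nat) (E : rel 'I_n) : 'M[R]_n :=
  \matrix_(i, j) if E j i then (out_degree E j)%:R^-1 else 0.

Definition push_sum_seq (R : realType) (n : nat) (Omega : Type)
    (G : nat -> Omega -> rel 'I_n) (w : Omega) : nat -> 'M[R]_n :=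
  fun t => push_sum_mx R (G t w).

Definition nontrivial (n : nat) (S : {set 'I_n}) : bool :=
  (S != finset.set0) && (S != finset.setT).

Section Flow.
Variables (R : realType) (n : nat).
Implicit Types (A : nat -> 'M[R]_n) (v : 'cV[R]_n).

Definition cut_flow (M : 'M[R]_n) (S : {set 'I_n}) : R :=
  \sum_(i in S) \sum_(j in ~: S) M i j.

Definition directed_infinite_flow A : Prop :=
  forall S : {set 'I_n}, nontrivial S ->
    (\sum_(0 <= t <oo) (cut_flow (A t) S)%:E)%E = +oo%E.

Definition positive_flow A (s t' : nat) : bool :=
  [forall S : {set 'I_n},
     nontrivial S ==> (0 < \sum_(s <= t < t') cut_flow (A t) S)].

(* The value 0 is a dummy, taken only when no admissible time exists; this
   never happens for a sequence with the directed infinite flow property. *)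
Definition next_flow_time A (s : nat) : nat :=
  if pselect (exists t', (s < t')%N && positive_flow A s t') is left ex_t'
  then ex_minn ex_t' else 0%N.

Fixpoint flow_time A (q : nat) : nat :=
  if q is q'.+1 then next_flow_time A (flow_time A q') else 0%N.

(* With k_q = [flow_time A q], this is l_q = k_{qn} - k_{(q-1)n}; only q >= 1 is
   meaningful, and likewise below. *)
Definition flow_length A (q : nat) : nat :=
  (flow_time A (q * n) - flow_time A (q.-1 * n))%N.

Definition mixing_rate A (q : nat) : R :=
  1 - (n%:R ^+ flow_length A q)^-1.

Definition window_indices A (t s : nat) : set nat :=
  [set q : nat | [/\ (1 <= q)%N, (s <= flow_time A (q.-1 * n))%N
                 & (flow_time A (q * n) <= t)%N]]%classic.

(* The product over a set in [nat] is finitely supported: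
   when [flow_time A] is increasing, [window_indices A t s] is finite. *)
Definition mixing_factor A (t s : nat) : R :=
  \big[*%R/1]_(q \in window_indices A t s) mixing_rate A q.

Fixpoint trajectory A v (t : nat) : 'cV[R]_n :=
  if t is t'.+1 then A t' *m trajectory A v t' else v.

Definition push_sum_ratio A v (t : nat) (i : 'I_n) : R :=
  trajectory A v t i 0 / trajectory A (const_mx 1) t i 0.

Definition average v : R := n%:R^-1 * \sum_i v i 0.

Definition norm1 v : R := \sum_i `|v i 0|.

End Flow.

(* Main.v *)
Require Import Defs.
From HB Require Import structures.
From mathcomp Require Import all_boot all_order all_algebra.
From mathcomp Require Import all_classical all_reals all_analysis.

Set Implicit Arguments.
Unset Strict Implicit.
Unset Printing Implicit Defensive.

Import Order.TTheory GRing.Theory Num.Theory.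
Import numFieldNormedType.Exports.

Local Open Scope classical_set_scope.
Local Open Scope ring_scope.

(** Everything happens along one sample path.  Both push-sum iterations are
    linear with the same matrices, so with u = x(0) - xbar 1 the error
    satisfies x(t) - xbar y(t) = W(t-1) ... W(0) u, and z_i(t) - xbar is the
    i-th coordinate of that vector divided by y_i(t).  The vector u has zero
    coordinate sum and ||u||_1 <= 2 ||x(0)||_1, so it is enough to show that the
    products W(t-1) ... W(0) contract zero-sum vectors in the 1-norm by the
    factor Lambda_{t,0}.

    A column-stochastic matrix whose entries are all at least delta acts on
    zero-sum vectors as if delta were subtracted from each entry; the column
    sums become 1 - n delta, hence so does the contraction factor
    ([zero_sum_contraction]).  With delta = 0 this makes every step
    nonexpansive, and it remains to find delta = n^(-l_q) for the product over
    the q-th window [k_{(q-1)n}, k_{qn}).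

    A positive entry of a product of m push-sum matrices is at least n^(-m),
    because it is at least the weight of one path of m edges, each of weight at
    least 1/n ([transition_bound]).  All entries of the window product are positive: the
    set of nodes reached from a given j never shrinks, thanks to the self-loops,
    and in each of the n blocks [k_p, k_{p+1}) of the window it gains a node
    unless it is already full, since some edge leaves it during the block
    ([support_grows]).  So the window contracts by 1 - n n^(-l_q), which is at
    most lambda_q. *)

(** * Contraction of zero-sum vectors *)

Definition column_stochastic (R : realType) (n : nat) (M : 'M[R]_n) : Prop :=
  forall j, \sum_i M i j = 1.

Lemma norm1_ge0 (R : realType) (n : nat) (u : 'cV[R]_n) : 0 <= norm1 u.
Proof. exact: sumr_ge0. Qed.

(** On zero-sum vectors [M] and [M - delta 1 1^T] act alike, and the latter is
    still nonnegative, with column sums [1 - n delta]. *)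
Lemma zero_sum_contraction (R : realType) (n : nat) (M : 'M[R]_n)
    (u : 'cV[R]_n) (delta : R) :
  column_stochastic M -> (forall i j, delta <= M i j) -> \sum_i u i 0 = 0 ->
  norm1 (M *m u) <= (1 - n%:R * delta) * norm1 u.
Proof.
move=> stoM geM u0.
have shift i : (M *m u) i 0 = \sum_k (M i k - delta) * u k 0.
  under eq_bigr do rewrite mulrBl.
  by rewrite big_split /= sumrN -mulr_sumr u0 mulr0 subr0 mxE.
have -> : (1 - n%:R * delta) * norm1 u
    = \sum_i \sum_k (M i k - delta) * `|u k 0|.
  rewrite exchange_big /= /norm1 mulr_sumr; apply: eq_bigr => k _.
  rewrite -mulr_suml; congr (_ * _).
  by rewrite big_split /= stoM sumr_const card_ord mulNrn mulr_natl.
apply: ler_sum => i _; rewrite shift.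
apply: le_trans (ler_norm_sum _ _ _) _.
apply: ler_sum => k _.
by rewrite normrM ger0_norm // subr_ge0.
Qed.

Lemma sum_mulmx (R : realType) (n : nat) (M : 'M[R]_n) (v : 'cV[R]_n) :
  column_stochastic M -> \sum_i (M *m v) i 0 = \sum_i v i 0.
Proof.
move=> stoM; under eq_bigr do rewrite mxE.
rewrite exchange_big; apply: eq_bigr => k _.
by rewrite -mulr_suml stoM mul1r.
Qed.

(** * Push-sum matrices and their products *)

(** The properties of push-sum matrices on which the contraction rests; the
    uniform lower bound on positive entries replaces the exact out-degrees. *)
Record push_sum_like (R : realType) (n : nat) (M : 'M[R]_n) : Prop := {
  like_ge0 : forall i j, 0 <= M i j;
  like_stochastic : column_stochastic M;
  like_diag : forall i, 0 < M i i;
  like_bound : forall i j, 0 < M i j -> n%:R^-1 <= M i j }.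

Lemma push_sum_mx_like (R : realType) (n : nat) (E : rel 'I_n) :
  (forall i, E i i) -> push_sum_like (push_sum_mx R E).
Proof.
move=> loop.
have deg_gt0 j : (0 < out_degree E j)%N.
  by apply/card_gt0P; exists j; exact: loop.
have ge0 i j : 0 <= push_sum_mx R E i j.
  by rewrite mxE; case: ifP => // _; rewrite invr_ge0 ler0n.
split=> // [j|i|i j].
- under eq_bigr do rewrite mxE.
  rewrite -big_mkcond sumr_const /= -[_ *+ _]mulr_natr mulVf // pnatr_eq0.
  by rewrite -lt0n deg_gt0.
- by rewrite mxE loop invr_gt0 ltr0n.
- rewrite mxE; case: ifP => [_ _|_]; last by rewrite ltxx.
  rewrite lef_pV2 ?posrE ?ltr0n ?ler_nat ?deg_gt0 //.
    by rewrite -[leqRHS]card_ord; exact: max_card.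
  exact: leq_ltn_trans (ltn_ord j).
Qed.

(** Products are indexed by starting time and length, because the
    weight bound depends on the length alone. *)
Fixpoint transition (R : realType) (n : nat) (A : nat -> 'M[R]_n) (s m : nat)
    : 'M[R]_n :=
  if m is m'.+1 then A (s + m')%N *m transition A s m' else 1%:M.

Definition support (R : realType) (n : nat) (A : nat -> 'M[R]_n) (s m : nat)
    (j : 'I_n) : {set 'I_n} :=
  [set i | 0 < transition A s m i j]%SET.

Lemma trajectory_transition (R : realType) (n : nat) (A : nat -> 'M[R]_n)
    (v : 'cV[R]_n) (s m : nat) :
  trajectory A v (s + m) = transition A s m *m trajectory A v s.
Proof.
elim: m => [|m IH]; first by rewrite addn0 mul1mx.
by rewrite addnS /= IH mulmxA.
Qed.

Section PushSumLike.
Context (R : realType) (n : nat) (A : nat -> 'M[R]_n).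
Hypothesis likeA : forall t, push_sum_like (A t).

Lemma transition_ge0 s m i j : 0 <= transition A s m i j.
Proof.
elim: m i j => [|m IH] i j; first by rewrite mxE ler0n.
by rewrite mxE sumr_ge0 // => k _; rewrite mulr_ge0 // (like_ge0 (likeA _)).
Qed.

Lemma transition_stochastic s m : column_stochastic (transition A s m).
Proof.
elim: m => [|m IH] j.
  by rewrite (bigD1 j) //= mxE eqxx big1 ?addr0 // => i /negPf ij; rewrite mxE ij.
under eq_bigr do rewrite mxE.
rewrite exchange_big /= -[RHS](IH j); apply: eq_bigr => k _.
by rewrite -mulr_suml (like_stochastic (likeA _)) mul1r.
Qed.

Lemma transition_step s m i j k :
  0 < A (s + m)%N i k -> 0 < transition A s m k j ->
  0 < transition A s m.+1 i j.
Proof.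
move=> Aik Tkj; rewrite mxE (bigD1 k) //=.
apply: ltr_pwDl; first exact: mulr_gt0.
apply: sumr_ge0 => l _; apply: mulr_ge0; last exact: transition_ge0.
exact: like_ge0.
Qed.

(** A positive entry of the product dominates one summand with two positive
    factors, that is, the weight of a single path. *)
Lemma transition_bound s m i j :
  0 < transition A s m i j -> (n%:R ^+ m)^-1 <= transition A s m i j.
Proof.
elim: m i j => [|m IH] i j.
  by rewrite mxE expr0 invr1; case: eqP; rewrite ?ltxx.
move=> Tij.
have nonneg k : true -> 0 <= A (s + m)%N i k * transition A s m k j.
  by move=> _; apply: mulr_ge0; [exact: like_ge0|exact: transition_ge0].
have [k /= Tk] : exists k, true && (0 < A (s + m)%N i k * transition A s m k j).
  by apply: psumr_neq0P => // /eqP; apply/negP; move: Tij; rewrite mxE => /lt0r_neq0.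
have Aik : 0 < A (s + m)%N i k.
  rewrite lt0r (like_ge0 (likeA _)) andbT.
  by apply: contraTneq Tk => ->; rewrite mul0r ltxx.
have Tkj : 0 < transition A s m k j by rewrite -(pmulr_rgt0 _ Aik).
rewrite exprS invfM mxE (bigD1 k) //=.
apply: ler_wpDr; first by apply: sumr_ge0 => l _; exact: nonneg.
apply: ler_pM; rewrite ?invr_ge0 ?exprn_ge0 ?ler0n //; last exact: IH.
exact: like_bound.
Qed.

Lemma support_mono s j a b : (a <= b)%N ->
  support A s a j \subset support A s b j.
Proof.
move=> /subnKC <-; elim: (b - a)%N => [|m IH]; first by rewrite addn0.
apply: fintype.subset_trans IH _; apply/fintype.subsetP => i; rewrite !inE addnS.
by apply: transition_step; exact: like_diag.
Qed.

Lemma support_self s m j : j \in support A s m j.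
Proof.
apply: (fintype.subsetP (support_mono s j (leq0n m))).
by rewrite inE mxE eqxx ltr01.
Qed.

Lemma cut_flow_ge0 t S : 0 <= cut_flow (A t) S.
Proof. by do 2![apply: sumr_ge0 => ? _]; exact: like_ge0. Qed.

(** If the support kept the same cardinality over the block, it would be one
    constant proper set [S], nonempty as it contains [j].  The cut from [S] into
    its complement carries flow at some time of the block, along an edge that
    brings a new node into the support. *)
Lemma support_grows s j a b : (a <= b)%N ->
  positive_flow A (s + a) (s + b) -> (#|support A s a j| < n)%N ->
  (#|support A s a j| < #|support A s b j|)%N.
Proof.
move=> ab /forallP flow small.
have sub := support_mono s j ab.
rewrite ltn_neqAle subset_leq_card // andbT.
apply/negP => /eqP /subset_cardP /(_ sub) eqS.
set S := support A s a j in small sub eqS.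
have /implyP := flow (~: S)%SET.
have -> : nontrivial (~: S) = true.
  apply/andP; split; apply/negP => /eqP /finset.setP.
    move=> SC0; move: small; rewrite ltnNge -{1}(card_ord n) => /negP; apply.
    apply/subset_leq_card/fintype.subsetP => i _.
    by have := SC0 i; rewrite !inE => /negbFE.
  by move=> /(_ j); rewrite inE support_self inE.
move=> /(_ isT) pos.
have /hasP[t] : has (fun t => 0 < cut_flow (A t) (~: S)) (index_iota (s + a) (s + b)).
  apply: contraTT pos => /hasPn none; rewrite -leNgt big_seq.
  by apply: sumr_le0 => t /none; rewrite -leNgt.
rewrite mem_index_iota => /andP[at_ tb].
rewrite lt0r cut_flow_ge0 andbT => /eqP.
(* Positive flow at time t exhibits an edge from some k in S to some i outside. *)
have row_ge0 i : i \in ~: S -> 0 <= \sum_(k in ~: ~: S) A t i k.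
  by move=> _; apply: sumr_ge0 => k _; exact: like_ge0.
move=> /(psumr_neq0P row_ge0)[i /andP[iS]]; rewrite lt0r => /andP[/eqP + _].
have ent_ge0 k : k \in ~: ~: S -> 0 <= A t i k by move=> _; exact: like_ge0.
move=> /(psumr_neq0P ent_ge0)[k /andP[]]; rewrite finset.setCK => kS Aik.
have st : (s <= t)%N by apply: leq_trans at_; exact: leq_addr.
have a_t : (a <= t - s)%N by rewrite leq_subRL.
have t_b : (t - s < b)%N by rewrite ltn_subLR.
have kt : k \in support A s (t - s) j := fintype.subsetP (support_mono s j a_t) _ kS.
have : i \in support A s b j.
  apply: (fintype.subsetP (support_mono s j t_b)); rewrite inE.
  by apply: transition_step (k) _ _; rewrite ?subnKC //; move: kt; rewrite inE.
by rewrite -eqS; move: iS; rewrite inE => /negPf ->.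
Qed.

End PushSumLike.

(** * Flow times and windows *)

Section FlowTimes.
Context (R : realType) (n : nat) (A : nat -> 'M[R]_n).
Hypothesis likeA : forall t, push_sum_like (A t).
Hypothesis flowA : directed_infinite_flow A.

(** A divergent series has no vanishing tail, so each cut receives flow at some
    time after [s]; there are finitely many cuts, and the latest such time
    serves them all. *)
Lemma positive_flow_exists s :
  exists t', (s < t')%N && positive_flow A s t'.
Proof.
have /choice[T posT] : forall S : {set 'I_n}, exists T : nat,
    nontrivial S -> 0 < \sum_(s <= t < T) cut_flow (A t) S.
  move=> S; case: (boolP (nontrivial S)) => [ntS|]; last by exists 0%N.
  apply: contrapT => /forallNP none.
  have cut0 t : (s <= t)%N -> cut_flow (A t) S = 0.
    move=> st; apply/eqP; rewrite eq_le cut_flow_ge0 // andbT leNgt.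
    apply/negP => pos; apply: (none t.+1) => _.
    rewrite big_nat_recr //=; apply: ltr_wpDl => //.
    by apply: sumr_ge0 => r _; exact: cut_flow_ge0.
  have := flowA ntS; rewrite (nneseries_split 0 s); last first.
    by move=> t _; rewrite lee_fin cut_flow_ge0.
  rewrite [X in (_ + X)%E]eseries0; last by move=> t st _; rewrite cut0.
  by rewrite adde0 sumEFin.
exists (maxn s.+1 (\max_S T S)); rewrite leq_max leqnn /=.
apply/forallP => S; apply/implyP => ntS.
apply: lt_le_trans (posT S ntS) _.
have sT : (s <= T S)%N.
  rewrite leqNgt; apply/negP => /ltnW Ts.
  by have := posT S ntS; rewrite big_geq ?ltxx.
rewrite [leRHS](big_cat_nat sT) /=; last by rewrite leq_max leq_bigmax orbT.
by rewrite lerDl; apply: sumr_ge0 => t _; exact: cut_flow_ge0.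
Qed.

Lemma flow_timeP q : (flow_time A q < flow_time A q.+1)%N /\
  positive_flow A (flow_time A q) (flow_time A q.+1).
Proof.
rewrite /= /next_flow_time; case: pselect => [ex_t'|[]].
  by case: ex_minnP => t' /andP[].
exact: positive_flow_exists.
Qed.

Lemma flow_time_lt : {homo flow_time A : p q / (p < q)%N}.
Proof.
by apply: homo_ltn => [? ? ?|q]; [exact: ltn_trans|case: (flow_timeP q)].
Qed.

Lemma flow_time_le : {mono flow_time A : p q / (p <= q)%N}.
Proof. exact: leq_mono flow_time_lt. Qed.

(** The support starts with the single node [j] and gains at least one node per
    block until it is full. *)
Lemma support_after_blocks q p j :
  (minn n p.+1 <=
   #|support A (flow_time A q) (flow_time A (q + p) - flow_time A q) j|)%N.
Proof.
elim: p => [|p IH].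
  apply: leq_trans (geq_minr _ _) _; apply/card_gt0P; exists j.
  exact: support_self.
set s := flow_time A q in IH *.
have le_s r : (s <= flow_time A (q + r))%N by rewrite flow_time_le leq_addr.
have ab : (flow_time A (q + p) - s <= flow_time A (q + p.+1) - s)%N.
  by rewrite leq_sub2r // flow_time_le leq_add2l.
have [full|small] := leqP n #|support A s (flow_time A (q + p) - s) j|.
  apply: leq_trans (geq_minl _ _) (leq_trans full _).
  exact/subset_leq_card/support_mono.
have : positive_flow A (s + (flow_time A (q + p) - s))
                       (s + (flow_time A (q + p.+1) - s)).
  by rewrite !subnKC // addnS; case: (flow_timeP (q + p)).
move=> /(support_grows likeA ab)/(_ small); apply: leq_trans.
rewrite (leq_trans (geq_minr _ _)) // ltnS; move: IH; rewrite geq_min.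
by rewrite leqNgt small.
Qed.

(** A window has [n] blocks, enough to fill the support of every column, so
    that each entry is positive and the weight bound for paths applies to it. *)
Lemma window_transition_bound q i j :
  (n%:R ^+ flow_length A q.+1)^-1
    <= transition A (flow_time A (q * n)) (flow_length A q.+1) i j.
Proof.
apply: transition_bound => //.
have /= := support_after_blocks (q * n) n j.
rewrite (minn_idPl (leqnSn n)) addnC -mulSn -/(flow_length A q.+1) => full.
set S := support _ _ _ _ in full.
have : i \in S.
  suff /eqP -> : S == finset.setT by rewrite inE.
  by rewrite eqEcard finset.subsetT cardsT card_ord.
by rewrite inE.
Qed.

Lemma flow_length_gt0 q : (0 < n)%N -> (0 < q)%N -> (0 < flow_length A q)%N.
Proof.
case: q => // q n0 _; rewrite subn_gt0; apply: flow_time_lt.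
by rewrite ltn_pmul2r.
Qed.

Lemma mixing_rate_in01 q : (2 <= n)%N -> (0 < q)%N -> 0 < mixing_rate A q < 1.
Proof.
move=> n2 q0.
have n0 : 0 < n%:R :> R by rewrite ltr0n (leq_trans _ n2).
rewrite /mixing_rate subr_gt0 gtrBl invr_gt0 exprn_gt0 // andbT.
rewrite invf_lt1 ?exprn_gt0 // exprn_egt1 ?ltr1n //.
by rewrite -lt0n flow_length_gt0 // (leq_trans _ n2).
Qed.

Lemma zero_sum_trajectory (u : 'cV[R]_n) t :
  \sum_i u i 0 = 0 -> \sum_i trajectory A u t i 0 = 0.
Proof.
move=> u0; elim: t => [//|t IH] /=.
by rewrite sum_mulmx //; exact: like_stochastic.
Qed.

Lemma zero_sum_nonexpansive (u : 'cV[R]_n) s t : \sum_i u i 0 = 0 ->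
  (s <= t)%N -> norm1 (trajectory A u t) <= norm1 (trajectory A u s).
Proof.
move=> u0 /subnKC <-; rewrite trajectory_transition.
rewrite -[leRHS]mul1r -[X in X * _](subr0 1) -[X in 1 - X](mulr0 n%:R).
apply: zero_sum_contraction; last exact: zero_sum_trajectory.
  exact: transition_stochastic.
by move=> i j; exact: transition_ge0.
Qed.

(** The contraction [1 - n n^(-l)] over a window is relaxed to the mixing rate
    [1 - n^(-l)]. *)
Lemma zero_sum_windows (u : 'cV[R]_n) q : (2 <= n)%N -> \sum_i u i 0 = 0 ->
  norm1 (trajectory A u (flow_time A (q * n)))
    <= \prod_(1 <= p < q.+1) mixing_rate A p * norm1 u.
Proof.
move=> n2 u0; elim: q => [|q IH]; first by rewrite big_nil mul1r.
have /andP[rate0 _] := mixing_rate_in01 n2 (ltn0Sn q).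
rewrite big_nat_recr //= mulrAC; apply: le_trans (_ : _ <= mixing_rate A q.+1 *
  norm1 (trajectory A u (flow_time A (q * n)))) _; last first.
  by rewrite [leRHS]mulrC ler_pM2l.
have -> : flow_time A (q.+1 * n)
    = (flow_time A (q * n) + flow_length A q.+1)%N.
  by rewrite subnKC // flow_time_le leq_pmul2r ?(leq_trans _ n2).
rewrite trajectory_transition.
apply: le_trans (zero_sum_contraction (transition_stochastic likeA _ _)
  (@window_transition_bound q) (zero_sum_trajectory _ u0)) _.
apply: ler_wpM2r; first exact: norm1_ge0.
rewrite lerD2l lerN2 ler_peMl ?invr_ge0 ?exprn_ge0 ?ler0n // ler1n.
exact: leq_trans n2.
Qed.

(** Flow times increase strictly, so the windows completed by time [t] form an
    initial segment and the product over a set is an ordinary one. *)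
Lemma mixing_factor_prod t q : (0 < n)%N ->
  (flow_time A (q * n) <= t < flow_time A (q.+1 * n))%N ->
  mixing_factor A t 0 = \prod_(1 <= p < q.+1) mixing_rate A p.
Proof.
move=> n0 /andP[qt tq]; rewrite fsbig_seq ?iota_uniq //.
congr (\big[_/_]_(p \in _) _); apply/seteqP; split => p /=.
- move=> [p0 _ pt]; rewrite mem_index_iota p0 /= ltnNge; apply/negP => qp.
  have := leq_ltn_trans pt tq; apply/negP; rewrite -leqNgt flow_time_le.
  by rewrite leq_pmul2r.
- rewrite mem_index_iota ltnS => /andP[p0 pq]; split => //.
  by apply: leq_trans qt; rewrite flow_time_le leq_pmul2r.
Qed.

Lemma last_window t : (0 < n)%N ->
  exists q, (flow_time A (q * n) <= t < flow_time A (q.+1 * n))%N.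
Proof.
move=> n0.
have ex0 : exists q, (flow_time A (q * n) <= t)%N by exists 0%N.
have bound q : (flow_time A (q * n) <= t)%N -> (q <= t)%N.
  (* Strict monotonicity gives r <= k_r, hence q <= q n <= k_{q n} <= t. *)
  apply: leq_trans; apply: (@leq_trans (q * n)); first exact: leq_pmulr.
  elim: (q * n)%N => // r IH; apply: leq_ltn_trans IH _.
  by case: (flow_timeP r).
case: (ex_maxnP ex0 bound) => q qt max_q; exists q; rewrite qt /= ltnNge.
by apply/negP => /max_q; rewrite ltnn.
Qed.

Lemma zero_sum_mixing (u : 'cV[R]_n) t : (2 <= n)%N -> \sum_i u i 0 = 0 ->
  norm1 (trajectory A u t) <= mixing_factor A t 0 * norm1 u.
Proof.
move=> n2 u0; have n0 : (0 < n)%N by exact: leq_trans n2.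
have [q window] := last_window t n0.
rewrite (mixing_factor_prod n0 window); apply: le_trans (zero_sum_windows q n2 u0).
by apply: zero_sum_nonexpansive => //; case/andP: window.
Qed.

End FlowTimes.

(** * Centring and the bound on the ratio *)

Lemma trajectory_sub_scale (R : realType) (n : nat) (A : nat -> 'M[R]_n)
    (v w : 'cV[R]_n) (c : R) (t : nat) :
  trajectory A (v - c *: w) t = trajectory A v t - c *: trajectory A w t.
Proof. by elim: t => [//|t IH] /=; rewrite IH mulmxBr scalemxAr. Qed.

Lemma trajectory_ones_gt0 (R : realType) (n : nat) (A : nat -> 'M[R]_n)
    (t : nat) (i : 'I_n) : (forall t, push_sum_like (A t)) ->
  0 < trajectory A (const_mx 1) t i 0.
Proof.
move=> likeA; elim: t i => [|t IH] i /=; first by rewrite mxE ltr01.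
rewrite mxE (bigD1 i) //=; apply: ltr_pwDl.
  by apply: mulr_gt0 => //; exact: like_diag.
by apply: sumr_ge0 => k _; apply: mulr_ge0; [exact: like_ge0|exact: ltW].
Qed.

Lemma sum_centred (R : realType) (n : nat) (v : 'cV[R]_n) : (0 < n)%N ->
  \sum_i (v - average v *: const_mx 1) i 0 = 0.
Proof.
move=> n0; under eq_bigr do rewrite !mxE mulr1.
rewrite big_split /= sumr_const card_ord mulNrn -mulr_natl mulrA mulfV ?mul1r ?subrr //.
by rewrite pnatr_eq0 -lt0n.
Qed.

(** The average has modulus at most [norm1 v / n] and is subtracted [n] times. *)
Lemma norm1_centred (R : realType) (n : nat) (v : 'cV[R]_n) : (0 < n)%N ->
  norm1 (v - average v *: const_mx 1) <= 2 * norm1 v.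
Proof.
move=> n0.
have nR : n%:R != 0 :> R by rewrite pnatr_eq0 -lt0n.
apply: le_trans (_ : \sum_i (`|v i 0| + `|average v|) <= _).
  by apply: ler_sum => i _; rewrite !mxE mulr1 ler_normB.
rewrite big_split /= sumr_const card_ord mulr_natl mulr2n lerD2l.
rewrite -mulr_natl normrM ger0_norm ?invr_ge0 ?ler0n // mulrA mulfV // mul1r.
exact: ler_norm_sum.
Qed.

(** The error at time [t + 1] is the trajectory of the centred initial state,
    over [y]; the last step costs nothing as it is nonexpansive. *)
Lemma push_sum_ratio_bound (R : realType) (n : nat) (A : nat -> 'M[R]_n)
    (v : 'cV[R]_n) (i : 'I_n) (t : nat) :
  (2 <= n)%N -> (forall t, push_sum_like (A t)) -> directed_infinite_flow A ->
  `| push_sum_ratio A v t.+1 i - average v |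
    <= 2 * norm1 v / trajectory A (const_mx 1) t.+1 i 0 * mixing_factor A t 0.
Proof.
move=> n2 likeA flowA.
have n0 : (0 < n)%N by exact: leq_trans n2.
set y := trajectory A (const_mx 1) t.+1 i 0.
have y0 : 0 < y by exact: trajectory_ones_gt0.
set u := v - average v *: const_mx 1.
have u0 : \sum_i u i 0 = 0 by exact: sum_centred.
have -> : push_sum_ratio A v t.+1 i - average v = trajectory A u t.+1 i 0 / y.
  have entry (a b : 'cV[R]_n) c : (a - c *: b) i 0 = a i 0 - c * b i 0.
    by rewrite !mxE.
  rewrite trajectory_sub_scale entry /push_sum_ratio -/y.
  by rewrite mulrBl mulfK // gt_eqF.
rewrite normrM normfV (gtr0_norm y0) mulrAC ler_pM2r ?invr_gt0 //.
have coord : `|trajectory A u t.+1 i 0| <= norm1 (trajectory A u t.+1).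
  by rewrite /norm1 (bigD1 i) //= lerDl sumr_ge0.
apply: le_trans coord _.
apply: le_trans (zero_sum_nonexpansive likeA u0 (leqnSn t)) _.
apply: le_trans (zero_sum_mixing likeA flowA t n2 u0) _.
rewrite mulrC; apply: ler_wpM2r; last exact: norm1_centred.
have [q window] := last_window likeA flowA t n0.
rewrite (mixing_factor_prod likeA flowA n0 window) big_nat.
apply: prodr_ge0 => p /andP[p0 _].
by have /andP[/ltW] := mixing_rate_in01 likeA flowA n2 p0.
Qed.

Theorem theorem1 (R : realType) (d : measure_display) (Omega : measurableType d)
  (mu : probability Omega R) (n : nat) (n_ge2 : (2 <= n)%N)
  (G : nat -> Omega -> rel 'I_n)
  (G_measurable : forall (t : nat) (j i : 'I_n),
     measurable [set w : Omega | G t w j i])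
  (G_loop : forall (t : nat) (w : Omega) (i : 'I_n), G t w i i)
  (x0 : 'cV[R]_n)
  (W_flow : {ae mu, forall w : Omega,
     directed_infinite_flow (push_sum_seq R G w)}) :
  {ae mu, forall w : Omega,
     (forall q : nat, (1 <= q)%N -> 0 < mixing_rate (push_sum_seq R G w) q < 1) /\
     (forall (i : 'I_n) (t : nat),
        `| push_sum_ratio (push_sum_seq R G w) x0 t.+1 i - average x0 |
        <= 2 * norm1 x0 / trajectory (push_sum_seq R G w) (const_mx 1) t.+1 i 0
           * mixing_factor (push_sum_seq R G w) t 0)}.
Proof.
apply: filterS W_flow => w flow_w.
have like_w t : push_sum_like (push_sum_seq R G w t).
  by apply: push_sum_mx_like => i; exact: G_loop.
split=> [q q0|i t]; first exact: mixing_rate_in01.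
exact: push_sum_ratio_bound.
Qed.
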